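(* Let $p_{11},p_{12},p_{21},p_{22}$ (functions of $d_1,d_2>0$) be the joint distribution of the pair of latent variables $(C_i,C_j)\in\{1,2\}^2$, conditional on the allocation of all other latent variables, as defined in the context. Suppose $S_{\{1\backslash b\}}$ and $S_{\{2\backslash b\}}$ are non-singular, $n_{1\backslash b}>0$, $n_{2\backslash b}>0$, and $\overline{Y}_{\{1\backslash b\}}\neq 0$, $\overline{Y}_{\{2\backslash b\}}\neq 0$. If $d_1\to\infty$ and $d_2\to\infty$ with $d_1$ and $d_2$ of the same order (i.e. $d_1=\mathcal{O}(d_2)$ and $d_2=\mathcal{O}(d_1)$), then $$\mathrm{Cor}(C_i,C_j)\to 1 .$$
   Context: Data $Y_1,\dots,Y_N\in\mathbb{R}^D$ are modelled by a two-component ($K=2$) collapsed Bayesian Gaussian mixture with latent allocations $C_n\in\{1,2\}$. Fix two distinct indices $i,j$ and put $\{b\}=\{i,j\}$. The allocations $C_n$, $n\notin\{b\}$, are fixed. For $k=1,2$: $\{k\backslash b\}=\{n\notin\{i,j\}: C_n=k\}$, $n_{k\backslash b}$ is its cardinality, $\overline{Y}_{\{k\backslash b\}}$ is the mean of the $Y_n$ with $n\in\{k\backslash b\}$, and $$S_{\{k\backslash b\}}=\Sigma_0+\sum_{n\in\{k\backslash b\}}(Y_n-\overline{Y}_{\{k\backslash b\}})(Y_n-\overline{Y}_{\{k\backslash b\}})^T,$$ where $\Sigma_0$ is a positive definite $D\times D$ matrix (prior parameter). The data are translated so that $\tfrac12(Y_i+Y_j)=0$, and $V_{\{ij\}}=Y_iY_i^T+Y_jY_j^T$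 is the centered sum of squares of $Y_i,Y_j$. The matrices $S_{\{k\backslash b\}}$, $V_{\{ij\}}$ and the vectors $\overline{Y}_{\{k\backslash b\}},Y_i,Y_j$ do not depend on $d_1,d_2$; the scale factors $d_k$ multiply the component means, moving them away from $Y_i,Y_j$. Write $|\cdot|$ for the determinant. Here $p_{lm}=P(C_i=l,C_j=m)$ is given by $$p_{11}=\Gamma_{11}\Bigl|S_{\{1\backslash b\}}+\tfrac{2n_{1\backslash b}}{n_{1\backslash b}+2}(d_1\overline{Y}_{\{1\backslash b\}})(d_1\overline{Y}_{\{1\backslash b\}})^T+V_{\{ij\}}\Bigr|^{-(n_{1\backslash b}+2)/2}\bigl|S_{\{2\backslash b\}}\bigr|^{-n_{2\backslash b}/2},$$ $$p_{12}=\Gamma_{12}\Bigl|S_{\{1\backslash b\}}+\tfrac{n_{1\backslash b}}{n_{1\backslash b}+1}(d_1\overline{Y}_{\{1\backslash b\}}-Y_i)(d_1\overline{Y}_{\{1\backslash b\}}-Y_i)^T\Bigr|^{-(n_{1\backslash b}+1)/2}\Bigl|S_{\{2\backslash b\}}+\tfrac{n_{2\backslash b}}{n_{2\backslash b}+1}(d_2\overline{Y}_{\{2\backslash b\}}-Y_j)(d_2\overline{Y}_{\{2\backslash b\}}-Y_j)^T\Bigr|^{-(n_{2\backslash b}+1)/2},$$ $$p_{21}=\Gamma_{21}\Bigl|S_{\{1\backslash b\}}+\tfrac{n_{1\backslash b}}{n_{1\backslash b}+1}(d_1\overline{Y}_{\{1\backslash b\}}-Y_j)(d_1\overline{Y}_{\{1\backslash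 b\}}-Y_j)^T\Bigr|^{-(n_{1\backslash b}+1)/2}\Bigl|S_{\{2\backslash b\}}+\tfrac{n_{2\backslash b}}{n_{2\backslash b}+1}(d_2\overline{Y}_{\{2\backslash b\}}-Y_i)(d_2\overline{Y}_{\{2\backslash b\}}-Y_i)^T\Bigr|^{-(n_{2\backslash b}+1)/2},$$ $$p_{22}=\Gamma_{22}\bigl|S_{\{1\backslash b\}}\bigr|^{-n_{1\backslash b}/2}\Bigl|S_{\{2\backslash b\}}+\tfrac{2n_{2\backslash b}}{n_{2\backslash b}+2}(d_2\overline{Y}_{\{2\backslash b\}})(d_2\overline{Y}_{\{2\backslash b\}})^T+V_{\{ij\}}\Bigr|^{-(n_{2\backslash b}+2)/2},$$ where, with $I_{k=l}$ the indicator of $k=l$, $$\Gamma_{lm}=\gamma\prod_{k=1}^2\frac{\Gamma(\beta+n_{k\backslash b}+I_{k=l}+I_{k=m})\prod_{r=1}^D\Gamma(\nu_0+n_{k\backslash b}+I_{k=l}+I_{k=m}+1-r)}{(\kappa_0+n_{k\backslash b}+I_{k=l}+I_{k=m})^{D/2}},$$ $\kappa_0=0$ (flat prior on the mean), $\beta,\nu_0>0$ are hyperparameters such that all arguments of the gamma function above are positive, and $\gamma>0$ (depending on $d_1,d_2$ but not on $l,m$) is the normalizing constant making $p_{11}+p_{12}+p_{21}+p_{22}=1$. With $p_{l\cdot}=p_{l1}+p_{l2}$ and $p_{\cdot m}=p_{1m}+p_{2m}$, $$\mathrm{Cor}(C_i,C_j)=\frac{p_{11}-p_{1\cdot}p_{\cdot1}}{\sqrt{p_{1\cdot}\,p_{2\cdot}\,p_{\cdot1}\,p_{\cdot2}}}.$$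 *)

(* Defs.v *)
From mathcomp Require Import all_boot all_order all_algebra.
From mathcomp Require Import all_classical all_reals all_analysis.
Import Order.TTheory GRing.Theory Num.Theory.
Import numFieldNormedType.Exports.

Set Implicit Arguments.
Unset Strict Implicit.
Unset Printing Implicit Defensive.

Local Open Scope classical_set_scope.
Local Open Scope ring_scope.

Definition gammaf (R : realType) (x : R) : R :=
  \int[lebesgue_measure]_(t in `]0%R, +oo[%classic) (t `^ (x - 1) * expR (- t)).

Definition posdefmx (R : realType) (D : nat) (A : 'M[R]_D) : Prop :=
  A^T = A /\ forall v : 'cV[R]_D, v != 0 -> 0 < (v^T *m A *m v) 0 0.

(* The components 1 and 2 of the mixture are the two elements of 'I_2. *)
Definition comp1 : 'I_2 := ord0.
Definition comp2 : 'I_2 := ord_max.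

Definition outer (R : realType) (D : nat) (v : 'cV[R]_D) : 'M[R]_D := v *m v^T.

Section Model.
Variables (R : realType) (D N : nat).
(* Only the allocations C n with n different from i and j are used below. *)
Variables (Y : 'I_N -> 'cV[R]_D) (C : 'I_N -> 'I_2) (i j : 'I_N).
Variables (Sigma0 : 'M[R]_D) (beta nu0 : R).

Definition members (k : 'I_2) : {set 'I_N} :=
  [set n | (n \notin [set i; j]) && (C n == k)].

Definition size_b (k : 'I_2) : nat := #|members k|.

Definition mean_b (k : 'I_2) : 'cV[R]_D :=
  (size_b k)%:R^-1 *: \sum_(n in members k) Y n.

Definition scatter_b (k : 'I_2) : 'M[R]_D :=
  Sigma0 + \sum_(n in members k) outer (Y n - mean_b k).

(* The centered sum of squares of Y i and Y j, for data translated so that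
   their midpoint is the origin. *)
Definition V_b : 'M[R]_D := outer (Y i) + outer (Y j).

(* Size of component k once C_i = l and C_j = m. *)
Definition size_lm (l m k : 'I_2) : nat := (size_b k + (k == l) + (k == m))%N.

Definition Gamma_lm (kappa0 g : R) (l m : 'I_2) : R :=
  g * \prod_(k < 2)
    (gammaf (beta + (size_lm l m k)%:R)
      * (\prod_(1 <= r < D.+1) gammaf (nu0 + (size_lm l m k)%:R + 1 - r%:R))
      / (kappa0 + (size_lm l m k)%:R) `^ (D%:R / 2)).

Section Joint.
Variables (g d1 d2 : R).

Let G := Gamma_lm 0 g.
Let n1 : R := (size_b comp1)%:R.
Let n2 : R := (size_b comp2)%:R.
Let S1 := scatter_b comp1.
Let S2 := scatter_b comp2.
Let M1 := d1 *: mean_b comp1.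
Let M2 := d2 *: mean_b comp2.

Definition p11 : R :=
  G comp1 comp1
  * (\det (S1 + (2 * n1 / (n1 + 2)) *: outer M1 + V_b)) `^ (- ((n1 + 2) / 2))
  * (\det S2) `^ (- (n2 / 2)).

Definition p12 : R :=
  G comp1 comp2
  * (\det (S1 + (n1 / (n1 + 1)) *: outer (M1 - Y i))) `^ (- ((n1 + 1) / 2))
  * (\det (S2 + (n2 / (n2 + 1)) *: outer (M2 - Y j))) `^ (- ((n2 + 1) / 2)).

Definition p21 : R :=
  G comp2 comp1
  * (\det (S1 + (n1 / (n1 + 1)) *: outer (M1 - Y j))) `^ (- ((n1 + 1) / 2))
  * (\det (S2 + (n2 / (n2 + 1)) *: outer (M2 - Y i))) `^ (- ((n2 + 1) / 2)).

Definition p22 : R :=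
  G comp2 comp2
  * (\det S1) `^ (- (n1 / 2))
  * (\det (S2 + (2 * n2 / (n2 + 2)) *: outer M2 + V_b)) `^ (- ((n2 + 2) / 2)).

Definition joint (l m : 'I_2) : R :=
  if l == comp1 then (if m == comp1 then p11 else p12)
  else (if m == comp1 then p21 else p22).

End Joint.
End Model.

Definition corr (R : realType) (p : 'I_2 -> 'I_2 -> R) : R :=
  let row l := \sum_(m < 2) p l m in
  let col m := \sum_(l < 2) p l m in
  (p comp1 comp1 - row comp1 * col comp1)
  / Num.sqrt (row comp1 * row comp2 * col comp1 * col comp2).

(* Main.v *)
Require Import Defs.
From mathcomp Require Import all_boot all_order all_algebra.
From mathcomp Require Import all_classical all_reals all_analysis.
From mathcomp Require Import measurable_realfun ring lra.
Import Order.TTheory GRing.Theory Num.Theory.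
Import numFieldNormedType.Exports.

(** Why the correlation tends to 1.  Write [a, b, c, d] for the four joint
    probabilities [p11, p12, p21, p22].  Since they sum to 1, the correlation is
    [(a d - b c) / sqrt ((a + b) (c + d) (a + c) (b + d))], and dividing through
    by [a d] turns it into an expression in [b / a], [c / d], [c / a], [b / d]
    that tends to 1 as soon as these four ratios tend to 0 ([corr_cvg1]).  The
    normalizing constant cancels in each ratio.

    It remains to count powers.  By the matrix determinant lemma
    ([det_rank1]), [det (A + q (d m - y) (d m - y)^T)] equals
    [det A (1 + q (d m - y)^T A^-1 (d m - y))], which grows exactly like [d^2]
    when [A] is positive definite, [q > 0] and [m <> 0] ([det_outer_cvg]).
    Hence, apart from the normalizing constant, [p11] is of exact order
    [d1^-(n1+2)] and [p12], [p21] are of order [d1^-(n1+1) d2^-(n2+1)], so that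
    [p12 / p11] has order [d1 / d2^(n2+1)].
    With [d1 = O(d2)] and [n2 >= 1] this tends to 0 ([cvg_ratio0]); the ratios
    to [p22] are symmetric and use [d2 = O(d1)].

    Taking ratios requires all four probabilities to be positive.  For the
    determinants this is positivity of the determinant of a positive definite
    matrix ([posdefmx_det_gt0]).  For the Gamma factors it is [gammaf_gt0]: a
    divergent integral of reals has value 0, so the content of that lemma is
    that the Euler integral converges. *)

Local Open Scope classical_set_scope.
Local Open Scope ring_scope.

(** * Positivity of the Gamma function *)

(** A bounded nonnegative antiderivative on the open half-line bounds the
    integral: exhaust the half-line by compact intervals, where the fundamental
    theorem of calculus gives a difference of two values of [F].  The half-line
    is open because the Euler integrand may blow up at 0. *)
Lemma ge0_integral0y_le {R : realType} (F f : R -> R) (M : R) :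
  (forall t : R, 0 < t -> 0 <= F t <= M) ->
  (forall t : R, 0 < t -> is_derive t 1 F (f t)) ->
  {in `]0, +oo[, continuous f} ->
  (forall t : R, 0 < t -> 0 <= f t) ->
  (\int[lebesgue_measure]_(t in `]0%R, +oo[%classic) (f t)%:E <= M%:E)%E.
Proof.
move=> F0M dF cf f0.
pose I (n : nat) : set (measurableTypeR R) := `[n.+2%:R^-1, n.+2%:R]%classic.
have I0 n t : I n t -> 0 < t.
  rewrite /I /= in_itv /= => /andP[+ _].
  by apply: lt_le_trans; rewrite invr_gt0.
have UI : \bigcup_n I n = `]0%R, +oo[%classic.
  apply/seteqP; split => [t [n _ /I0]|t]; rewrite /= in_itv /= andbT // => t0.
  pose m := (Num.truncn t + Num.truncn t^-1)%N.
  have h (u : R) (k : nat) : 0 < u -> (Num.truncn u <= k)%N -> u <= k.+2%:R.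
    move=> u0 uk; apply/ltW/(lt_le_trans (truncnS_gt _)).
    by rewrite ler_nat ltnS; apply: leq_trans uk _.
  exists m => //; rewrite /I /= in_itv /=; apply/andP; split.
    by rewrite -[leRHS]invrK lef_pV2 ?posrE ?invr_gt0 ?ltr0n // h ?invr_gt0 ?leq_addl.
  by rewrite h ?leq_addr.
have ndI : nondecreasing_seq I.
  move=> m n mn; apply/subsetPset => t; rewrite /I /=; rewrite !in_itv /= => /andP[h1 h2].
  apply/andP; split.
    by apply: le_trans h1; rewrite lef_pV2 ?posrE ?ltr0n // ler_nat !ltnS.
  by apply: (le_trans h2); rewrite ler_nat !ltnS.
have cfI n : {within I n, continuous f}.
  apply: continuous_in_subspaceT => t /set_mem /I0 t0.
  by apply: cf; rewrite in_itv /= t0.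
have mI n : measurable (I n) by exact: measurable_itv.
have mf n : measurable_fun (I n) (fun t : R => (f t)%:E).
  apply/measurable_EFinP; exact: (subspace_continuous_measurable_fun (mI n) (cfI n)).
have H := @ge0_nondecreasing_set_cvg_integral _ _ R I (EFin \o f)
  lebesgue_measure ndI mI mf (fun n t h => f0 t (I0 n t h)).
have dcF t : 0 < t -> {for t, continuous F}.
  move=> /dF dFt; apply/differentiable_continuous/derivable1_diffP.
  by apply: ex_derive.
rewrite -UI; apply: cvge_to_le H _; apply: nearW => n.
have n0 : 0 < n.+2%:R :> R by rewrite ltr0n.
have nV0 : 0 < n.+2%:R^-1 :> R by rewrite invr_gt0.
rewrite (@continuous_FTC2 _ f F).
- rewrite -EFinB lee_fin.
  have /andP[_] := F0M _ n0; have /andP[+ _] := F0M _ nV0.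
  lra.
- by rewrite (@lt_trans _ _ 1) // ?invf_lt1 ?ltr1n.
- exact: cfI.
- split=> [t||].
  + rewrite in_itv /= => /andP[+ _] => /(lt_trans nV0) /dF ?.
    exact: ex_derive.
  + exact/cvg_at_right_filter/dcF.
  + exact/cvg_at_left_filter/dcF.
- move=> t; rewrite in_itv /= => /andP[+ _] => /(lt_trans nV0) /dF ?.
  by rewrite derive1E derive_val.
Qed.

Lemma continuous_powR_gt0 {R : realType} (a u : R) : 0 < u ->
  {for u, continuous (fun v : R => v `^ a)}.
Proof.
move=> u0; apply/differentiable_continuous/derivable1_diffP.
by apply: derivable_powR; rewrite in_itv /= u0.
Qed.

(** This integrand is the unnormalized beta prime density with parameters [x]
    and 1.  It has the explicit antiderivative [(t / (1 + t))^x], which stays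
    below 1, and behaves like [t^(x-1)] near 0 while decaying polynomially at
    infinity; it therefore dominates the Euler integrand on the whole
    half-line at once. *)
Lemma integral_betaprime_le1 {R : realType} {x : R} : 0 < x ->
  (\int[lebesgue_measure]_(t in `]0%R, +oo[%classic)
     (x * t `^ (x - 1) * (1 + t) `^ (- (x + 1)))%:E <= 1%:E)%E.
Proof.
move=> x0.
apply: (@ge0_integral0y_le _ (fun t => t `^ x * (1 + t) `^ (- x))).
- move=> t t0; have t1 : 0 < 1 + t by lra.
  rewrite mulr_ge0 ?powR_ge0 //= powRN ler_pdivrMr ?powR_gt0 // mul1r.
  by rewrite ge0_ler_powR ?nnegrE; lra.
- move=> t t0; have t1 : 0 < 1 + t by lra.
  have H1 : is_derive t 1 (fun t : R => 1 + t) 1.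
    have := @is_deriveD _ R R (cst (1 : R)) id t 1 _ _
      (is_derive_cst (1 : R) t 1) (is_derive_id t 1).
    by rewrite add0r.
  have H2 : is_derive t 1 (fun u : R => (1 + u) `^ (- x))
      (- x * (1 + t) `^ (- x - 1)).
    have := @is_derive1_comp _ (fun u : R => u `^ (- x)) (fun u => 1 + u) t
      _ _ (is_derive1_powR (- x) t1) H1.
    by rewrite mulr1.
  have H3 := is_derive1_powR x t0.
  apply: is_derive_eq.
  rewrite /GRing.scale /=.
  rewrite (_ : - (x + 1) = - x - 1); last by ring.
  rewrite [in t `^ x](_ : x = x - 1 + 1); last by ring.
  rewrite [in (1 + t) `^ (- x)](_ : - x = - x - 1 + 1); last by ring.
  rewrite !powRD ?(gt_eqF t0) ?(gt_eqF t1) ?implybT // !powRr1 ?ltW //.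
  ring.
- move=> t; rewrite in_itv /= andbT => t0; have t1 : 0 < 1 + t by lra.
  apply: cvgM.
    by apply: cvgM; [exact: cvg_cst|exact: continuous_powR_gt0].
  apply: (@continuous_comp _ _ _ (fun u : R => 1 + u) (fun v : R => v `^ _));
    last exact: continuous_powR_gt0.
  by apply: cvgD; [exact: cvg_cst|exact: cvg_id].
- by move=> t t0; rewrite !mulr_ge0 ?powR_ge0 // ltW.
Qed.

(** [u^a e^-u] is maximal at [u = a]: after taking logarithms this is
    [ln s <= s - 1] at [s = u / a]. *)
Lemma powR_expRN_le {R : realType} {a u : R} : 0 < a -> 0 < u ->
  u `^ a * expR (- u) <= a `^ a * expR (- a).
Proof.
move=> a0 u0; rewrite /powR !gt_eqF // -!expRD ler_expR.
have ua0 : 0 < u / a by rewrite divr_gt0.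
have /le_ln1Dx : -1 < u / a - 1 by lra.
rewrite addrC subrK ln_div ?posrE // lerBlDr => h.
have := ler_wpM2l (ltW a0) h.
rewrite !mulrDr mulrN1 mulrCA divff ?gt_eqF // mulr1.
lra.
Qed.

(** Convergence holds because [t^(x-1) e^-t] is at most a constant times the
    beta prime density [x t^(x-1) (1+t)^-(x+1)], the constant coming from
    [powR_expRN_le] at [u = 1 + t], [a = x + 1].  The value is positive because
    the integrand is at least [e^-2 / 2] on [[1, 2]]. *)
Lemma gammaf_gt0 {R : realType} {x : R} : 0 < x -> 0 < gammaf x.
Proof.
move=> x0; rewrite /gammaf /Rintegral.
set D : set (measurableTypeR R) := `]0%R, +oo[%classic.
pose f (t : R) : R := t `^ (x - 1) * expR (- t).
have mD : measurable D by exact: measurable_itv.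
have f0 t : 0 <= f t by rewrite mulr_ge0 ?powR_ge0 ?expR_ge0.
have mf : measurable_fun D (fun t : R => (f t)%:E).
  apply/measurable_EFinP; apply: measurable_funM.
    by apply: measurable_funTS; exact: measurable_powR.
  apply: measurable_funTS.
  by apply: measurableT_comp => //; exact: measurable_funN.
have foo : (\int[lebesgue_measure]_(t in D) (f t)%:E < +oo)%E.
  pose c := (x + 1) `^ (x + 1) * expR (- (x + 1)) * expR 1 / x.
  pose h (t : R) := x * t `^ (x - 1) * (1 + t) `^ (- (x + 1)).
  have c0 : 0 <= c by rewrite !mulr_ge0 ?invr_ge0 ?powR_ge0 ?expR_ge0 // ltW.
  have h0 t : 0 <= h t by rewrite !mulr_ge0 ?powR_ge0 // ltW.
  have mh : measurable_fun D (fun t : R => (h t)%:E).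
    apply/measurable_EFinP; apply: measurable_funM.
      apply: measurable_funM; first exact: measurable_cst.
      by apply: measurable_funTS; exact: measurable_powR.
    apply: measurable_funTS.
    apply: (measurableT_comp (measurable_powR _)).
    by apply: measurable_funD.
  apply: (@le_lt_trans _ _ (\int[lebesgue_measure]_(t in D) (c%:E * (h t)%:E))%E).
    apply: ge0_le_integral => //.
    - by move=> t _; rewrite lee_fin.
    - apply: measurable_funeM => //.
    - move=> t; rewrite /D /= in_itv /= andbT => t0; rewrite lee_fin.
      have t1 : 0 < 1 + t by lra.
      have xp : 0 < x + 1 by lra.
      have := powR_expRN_le xp t1.
      have -> : expR (- (1 + t)) = expR (- t) / expR 1.
        by rewrite -expRN -expRD; congr expR; lra.
      rewrite mulrA ler_pdivrMr ?expR_gt0 // => H.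
      rewrite /f /h /c powRN.
      set A := t `^ _; set P := (1 + t) `^ _.
      set K := _ * expR (- (x + 1)) in H *.
      have P0 : 0 < P by rewrite powR_gt0.
      have A0 : 0 <= A by rewrite powR_ge0.
      have -> : K * expR 1 / x * (x * A / P) = A * (K * expR 1 / P).
        by field; rewrite !gt_eqF.
      by apply: ler_wpM2l => //; rewrite ler_pdivlMr // mulrC.
  rewrite ge0_integralZl //.
  - apply: (@le_lt_trans _ _ (c%:E * 1%:E)%E); last by rewrite -EFinM ltry.
    by rewrite lee_wpmul2l ?lee_fin //; exact: integral_betaprime_le1.
  - by move=> t _; rewrite lee_fin.
apply: fine_gt0; apply/andP; split=> //.
pose E : set (measurableTypeR R) := `[1%R, 2%R]%classic.
have mE : measurable E by exact: measurable_itv.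
have ED : E `<=` D.
  by move=> t; rewrite /E /D /= !in_itv /= andbT => /andP[+ _]; lra.
apply: (@lt_le_trans _ _
  (\int[lebesgue_measure]_(t in E) (2^-1 * expR (- 2))%:E)%E).
  rewrite integral_cst //= lebesgue_measure_itv /= lte_fin ltr1n.
  rewrite -EFinD -EFinM lte_fin.
  by rewrite mulr_gt0 ?subr_gt0 ?ltr1n // mulr_gt0 ?expR_gt0 ?invr_gt0.
apply: (@le_trans _ _ (\int[lebesgue_measure]_(t in E) (f t)%:E)%E).
  apply: ge0_le_integral => //.
  - exact: measurable_funS mf.
  - move=> t; rewrite /E /= in_itv /= => /andP[t1 t2]; rewrite lee_fin /f.
    apply: ler_pM; rewrite ?invr_ge0 ?expR_ge0 ?ler_expR ?lerN2 //.
    (* [x > 0] makes [-1] a lower bound of the exponent, uniformly in [x] *)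
    apply: (@le_trans _ _ (t `^ (-1))).
      by rewrite powR_inv1 ?lef_pV2 ?posrE; lra.
    by rewrite ler_powR // ; lra.
by apply: ge0_subset_integral => // t _; rewrite lee_fin.
Qed.

(** * Positive definite matrices and rank-one updates *)

Section PosDef.
Context {R : realType} {D : nat}.
Implicit Types (A : 'M[R]_D) (v : 'cV[R]_D).

Lemma posdefmx_det_neq0 A : posdefmx A -> \det A != 0.
Proof.
move=> [_ Apos]; apply/det0P => -[v v0 vA].
have := Apos v^T; rewrite trmxK vA mul0mx mxE ltxx.
by rewrite -trmx0 (inj_eq trmx_inj) => /(_ v0).
Qed.

Lemma posdefmx_unit A : posdefmx A -> A \in unitmx.
Proof. by move=> /posdefmx_det_neq0; rewrite unitmxE unitfE. Qed.

Lemma sqnorm_gt0 v : v != 0 -> 0 < (v^T *m v) 0 0.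
Proof.
move=> v0; rewrite mxE; have /cV0Pn [k vk] := v0.
rewrite (bigD1 k) //= ltr_pwDl //.
  by rewrite mxE -expr2 lt_neqAle sqr_ge0 andbT eq_sym sqrf_eq0.
by apply: sumr_ge0 => l _; rewrite mxE -expr2 sqr_ge0.
Qed.

Lemma posdefmx_segment A (t : R) : posdefmx A -> 0 <= t <= 1 ->
  posdefmx (t *: (A - 1%:M) + 1%:M).
Proof.
move=> [AT Apos] /andP[t0 t1]; split.
  by rewrite linearD linearZ linearB /= AT trmx1.
move=> v v0; rewrite mulmxDr mulmxDl -scalemxAr -scalemxAl mulmxBr mulmxBl.
rewrite !mulmx1 !mxE.
have := Apos v v0; have := sqnorm_gt0 v v0; rewrite !mxE.
set a := \sum_j _; set b := \sum_j _ => a0 b0.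
have [->|tn0] := eqVneq t 0; first by rewrite mul0r add0r.
have tp : 0 < t by rewrite lt_neqAle eq_sym tn0.
nra.
Qed.

(** Along the segment from the identity to [A] all matrices are positive
    definite, so the determinant, a polynomial in the parameter, has no root
    there; being 1 at the identity, it is positive at [A] by the intermediate
    value theorem for polynomials. *)
Lemma posdefmx_det_gt0 A : posdefmx A -> 0 < \det A.
Proof.
move=> Apos.
pose p : {poly R} := \det ('X *: map_mx polyC (A - 1%:M) + 1%:M).
have pE t : p.[t] = \det (t *: (A - 1%:M) + 1%:M).
  rewrite -[LHS]/(horner_eval t p) -det_map_mx; congr (\det _).
  apply/matrixP => k l; rewrite !mxE -[LHS]/(horner _ t).
  by rewrite hornerD hornerM hornerX hornerC; case: (k == l); rewrite !hornerE.
rewrite ltNge; apply/negP => detA.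
have [||t t01 /eqP] := @poly_ivt R (- p) 0 1 => //.
  rewrite !hornerN !pE !scale0r add0r det1 scale1r subrK.
  by rewrite oppr_ge0 detA oppr_le0 ler01.
rewrite hornerN pE => /eqP; rewrite oppr_eq0; apply/negP/posdefmx_det_neq0.
exact: posdefmx_segment.
Qed.

Lemma posdefmx_inv A : posdefmx A -> posdefmx (invmx A).
Proof.
move=> Apos; have Au := posdefmx_unit A Apos; case: (Apos) => AT Av.
split; first by rewrite trmx_inv AT.
move=> v v0; have -> : v = A *m (invmx A *m v) by rewrite mulKVmx.
set w := invmx A *m v.
have w0 : w != 0.
  by apply: contra v0 => /eqP w0; rewrite -(mulKVmx Au v) -/w w0 mulmx0.
by rewrite trmx_mul AT -mulmxA mulKmx //; apply: Av.
Qed.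

Lemma posdefmxD_outer A v : posdefmx A -> posdefmx (A + outer v).
Proof.
move=> [AT Av]; split; first by rewrite linearD /= AT /outer trmx_mul trmxK.
move=> w w0; rewrite mulmxDr mulmxDl mxE ltr_pwDl ?Av //.
rewrite /outer !mulmxA -mulmxA -[w^T *m v](trmxK) trmx_mul trmxK.
by rewrite mxE big_ord1 mxE -expr2 sqr_ge0.
Qed.

Lemma posdefmxD_sum_outer A I (s : seq I) (P : pred I) (f : I -> 'cV[R]_D) :
  posdefmx A -> posdefmx (A + \sum_(n <- s | P n) outer (f n)).
Proof.
move=> Apos; elim/big_rec: _ => [|n B _ IH]; first by rewrite addr0.
by rewrite addrCA addrC; exact: posdefmxD_outer.
Qed.

(** The block matrix with rows [(1, -v)] and [(u, 1)] has two block-triangular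
    factorizations, one for each Schur complement; comparing determinants gives
    the formula. *)
Lemma det_1D_mul (u : 'cV[R]_D) (v : 'rV[R]_D) :
  \det (1%:M + u *m v) = 1 + (v *m u) 0 0.
Proof.
pose B := block_mx (1%:M : 'M[R]_1) (- v) u (1%:M : 'M[R]_D).
transitivity (\det B).
  have -> : B = block_mx 1%:M 0 u 1%:M *m block_mx 1%:M (- v) 0 (1%:M + u *m v).
    rewrite mulmx_block !mul0mx !mulmx0 !mul1mx !mulmx1 !addr0.
    by rewrite mulmxN addrCA addNr addr0.
  by rewrite det_mulmx det_lblock det_ublock !det1 !mul1r.
have -> : B = block_mx 1%:M (- v) 0 1%:M *m block_mx (1%:M + v *m u) 0 u 1%:M.
  by rewrite mulmx_block !mul0mx !mulmx0 !mul1mx !mulmx1 !add0r mulNmx addrK.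
by rewrite det_mulmx det_lblock det_ublock !det1 !mul1r mulr1 det_mx11 !mxE eqxx.
Qed.

Definition qform A v : R := (v^T *m A *m v) 0 0.

Lemma det_rank1 A v (c : R) : A \in unitmx ->
  \det (A + c *: outer v) = \det A * (1 + c * qform (invmx A) v).
Proof.
move=> Au.
have -> : A + c *: outer v = A *m (1%:M + (invmx A *m v) *m (c *: v^T)).
  by rewrite mulmxDr mulmx1 -!mulmxA mulKVmx // -scalemxAr.
by rewrite det_mulmx det_1D_mul -scalemxAl mxE mulmxA.
Qed.

Lemma qformZ A v (d : R) : qform A (d *: v) = d ^+ 2 * qform A v.
Proof.
by rewrite /qform [(d *: v)^T]linearZ /= -!scalemxAl -scalemxAr !mxE mulrA expr2.
Qed.

Lemma qformB A v w (e : R) :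
  qform A (v - e *: w) =
  qform A v - e * ((v^T *m A *m w) 0 0 + (w^T *m A *m v) 0 0)
    + e ^+ 2 * qform A w.
Proof.
rewrite -qformZ /qform [(v - _)^T]linearB /= [(e *: w)^T]linearZ /=.
rewrite !mulmxBl !mulmxBr -!scalemxAl -!scalemxAr.
rewrite !mxE; ring.
Qed.

Lemma det_outer_gt0 A v (c : R) : posdefmx A -> 0 <= c ->
  0 < \det (A + c *: outer v).
Proof.
move=> Apos c0.
rewrite det_rank1 ?posdefmx_unit // mulr_gt0 ?posdefmx_det_gt0 //.
rewrite ltr_pwDl // mulr_ge0 //.
have [->|v0] := eqVneq v 0; first by rewrite /qform mulmx0 mxE lexx.
by apply/ltW; case: (posdefmx_inv _ Apos) => _; apply.
Qed.
End PosDef.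

(** * Growth of the determinants and of the ratios *)

Section Asymptotics.
Context {R : realType} {T : Type} {F : set_system T} {FF : Filter F}.

Lemma cvgV_pinfty (d : T -> R) :
  d t @[t --> F] --> +oo -> (d t)^-1 @[t --> F] --> 0.
Proof.
move=> doo; apply/gtr0_cvgV0 => //.
exact: (cvgry_gt doo).
Qed.

Section Det.
Context {D : nat} (A : 'M[R]_D) (m y : 'cV[R]_D) (c : R) (d : T -> R).
Hypotheses (Apos : posdefmx A) (c0 : 0 < c) (m0 : m != 0).
Hypotheses (d0 : forall t, 0 < d t) (doo : d t @[t --> F] --> +oo).

Let h t := \det (A + c *: outer (d t *: m - y)).

(** Factoring [d] out of [d m - y] leaves [m - d^-1 y], whose quadratic form is
    a polynomial in [d^-1] with constant term the quadratic form of [m]. *)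
Lemma det_outer_cvg :
  h t / d t ^+ 2 @[t --> F] --> \det A * (c * qform (invmx A) m).
Proof.
pose B := invmx A.
pose b : R := (m^T *m B *m y) 0 0 + (y^T *m B *m m) 0 0.
have hE t : h t / d t ^+ 2 =
    \det A * ((d t)^-1 * (d t)^-1
      + c * (qform B m - (d t)^-1 * b + (d t)^-1 * (d t)^-1 * qform B y)).
  have dn0 : d t != 0 by rewrite gt_eqF.
  rewrite /h det_rank1 ?posdefmx_unit //.
  have -> : d t *: m - y = d t *: (m - (d t)^-1 *: y).
    by rewrite scalerBr scalerA divff // scale1r.
  rewrite qformZ qformB -/B -/b.
  by field.
have dV := cvgV_pinfty _ doo.
under eq_fun do rewrite hE.
rewrite -/B.
(* the limit is the expression in [hE] evaluated at [d^-1 = 0] *)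
rewrite (_ : c * qform B m =
  0 * 0 + c * (qform B m - 0 * b + 0 * 0 * qform B y)); last by ring.
apply: cvgM; first exact: cvg_cst.
apply: cvgD; first exact: cvgM.
apply: cvgM; first exact: cvg_cst.
apply: cvgD; last first.
  by apply: cvgM; [exact: cvgM|exact: cvg_cst].
apply: cvgB; first exact: cvg_cst.
by apply: cvgM => //; exact: cvg_cst.
Qed.

Lemma det_outer_powR_cvg (k : nat) : exists2 L : R, 0 < L &
  h t `^ (- (k%:R / 2)) * d t ^+ k @[t --> F] --> L.
Proof.
pose L := \det A * (c * qform (invmx A) m).
have L0 : 0 < L.
  rewrite !mulr_gt0 ?posdefmx_det_gt0 //.
  by case: (posdefmx_inv _ Apos) => _; apply.
exists (L `^ (- (k%:R / 2))); first exact: powR_gt0.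
have hE t : h t `^ (- (k%:R / 2)) * d t ^+ k =
    (h t / d t ^+ 2) `^ (- (k%:R / 2)).
  have d2 : 0 < d t ^+ 2 by rewrite exprn_gt0.
  have h0 : 0 < h t by apply: det_outer_gt0 => //; exact: ltW.
  rewrite powRM ?invr_ge0 ?ltW //; congr (_ * _).
  rewrite -(powR_inv1 (ltW d2)) -powRrM -(powR_mulrn 2 (ltW (d0 t))) -powRrM.
  rewrite -(powR_mulrn k (ltW (d0 t))).
  by congr (_ `^ _); field.
under eq_fun do rewrite hE.
apply: (@cvg_comp _ _ _ (fun t => h t / d t ^+ 2) (fun u : R => u `^ _)).
  exact: det_outer_cvg.
exact: continuous_powR_gt0.
Qed.
End Det.

(** After rescaling each [X] to its limit, what is left of [X1 X2 / X3] is
    [u / v^(m+1)], at most a constant times [1 / v^m].  This is where the scales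
    must be of the same order and [m >= 1]. *)
Lemma cvg_ratio0 (K L1 L2 L3 : R) (k m : nat) (X1 X2 X3 u v : T -> R) :
  0 < L3 -> (forall t, 0 < u t) -> (forall t, 0 < v t) ->
  v t @[t --> F] --> +oo ->
  (0 < m)%N ->
  (exists2 C : R, 0 < C & \forall t \near F, u t <= C * v t) ->
  X1 t * u t ^+ k @[t --> F] --> L1 ->
  X2 t * v t ^+ m.+1 @[t --> F] --> L2 ->
  X3 t * u t ^+ k.+1 @[t --> F] --> L3 ->
  K * (X1 t * X2 t / X3 t) @[t --> F] --> 0.
Proof.
move=> L30 u0 v0 voo m0 [C C0 uv] X1L X2L X3L.
have uv0 : u t / v t ^+ m.+1 @[t --> F] --> 0.
  have bnd : \forall t \near F, 0 <= u t / v t ^+ m.+1 <= C * (v t)^-1.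
    have v1 : \forall t \near F, 1 <= v t by apply: (cvgry_ge voo).
    near=> t; have vt0 := v0 t; have ut0 := u0 t.
    apply/andP; split; first by rewrite divr_ge0 ?exprn_ge0 ?ltW.
    rewrite ler_pdivrMr ?exprn_gt0 //.
    apply: (@le_trans _ _ (C * v t)); first by near: t.
    rewrite exprS mulrA mulfVK ?gt_eqF // ler_pM2l //.
    by rewrite -[leLHS]expr1; apply: ler_weXn2l => //; near: t.
  apply: (squeeze_cvgr bnd); first exact: cvg_cst.
  rewrite -(mulr0 C); apply: cvgM; first exact: cvg_cst.
  exact: cvgV_pinfty.
have E t : K * (X1 t * X2 t / X3 t) =
   K * ((X1 t * u t ^+ k) * (X2 t * v t ^+ m.+1) / (X3 t * u t ^+ k.+1)
        * (u t / v t ^+ m.+1)).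
  congr (K * _).
  have [->|X30] := eqVneq (X3 t) 0; first by rewrite !(invr0, mulr0, mul0r).
  have un0 : u t != 0 by rewrite gt_eqF.
  have vn0 : v t != 0 by rewrite gt_eqF.
  rewrite !exprS; field.
  by rewrite X30 un0 vn0 !expf_neq0.
under eq_fun do rewrite E.
rewrite (_ : 0 = K * (L1 * L2 / L3 * 0)); last by rewrite !mulr0.
apply: cvgM; first exact: cvg_cst.
apply: cvgM => //; apply: cvgM; first exact: cvgM.
by apply: cvgV => //; rewrite gt_eqF.
Unshelve. all: by end_near. Qed.

(** Only the ratios of off-diagonal to diagonal entries matter: divide numerator
    and denominator of the correlation by [p 1 1 * p 2 2]. *)
Lemma corr_cvg1 (p : T -> 'I_2 -> 'I_2 -> R) :
  (forall t l m, 0 < p t l m) ->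
  (forall t, \sum_(l < 2) \sum_(m < 2) p t l m = 1) ->
  (forall l m, l != m -> forall k,
     p t l m / p t k k @[t --> F] --> 0) ->
  corr (p t) @[t --> F] --> (1 : R).
Proof.
move=> p0 p1 pr.
pose r l m k t := p t l m / p t k k.
pose x := r comp1 comp2 comp1; pose y := r comp2 comp1 comp2.
pose z := r comp2 comp1 comp1; pose w := r comp1 comp2 comp2.
have E t : corr (p t) = (1 - x t * y t) /
    Num.sqrt ((1 + x t) * (1 + y t) * (1 + z t) * (1 + w t)).
  have := p1 t; rewrite /corr !big_ord_recl !big_ord0.
  have -> : lift ord0 ord0 = comp2 :> 'I_2 by apply/val_inj.
  rewrite -/comp1 !addr0 /x /y /z /w /r.
  move: (p0 t comp1 comp1) (p0 t comp1 comp2).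
  move: (p0 t comp2 comp1) (p0 t comp2 comp2).
  move: (p t comp1 comp1) (p t comp1 comp2) (p t comp2 comp1) (p t comp2 comp2).
  move=> a b c d c0 d0 a0 b0 s1.
  have -> : (a + b) * (c + d) * (a + c) * (b + d) =
      (a * d) ^+ 2
      * ((1 + b / a) * (1 + c / d) * (1 + c / a) * (1 + b / d)).
    by field; rewrite !gt_eqF.
  rewrite sqrtrM ?sqr_ge0 // sqrtr_sqr gtr0_norm ?mulr_gt0 //.
  rewrite invfM [LHS]mulrA.
  congr (_ / _).
  (* homogenizing with [a + b + c + d = 1] gives the numerator [a d - b c] *)
  have -> : a - (a + b) * (a + c) = a * (a + b + (c + d)) - (a + b) * (a + c).
    by rewrite s1 mulr1.
  by field; rewrite !gt_eqF.
have ne : comp1 != comp2 by [].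
have ne' : comp2 != comp1 by [].
have D1 l m k : l != m -> 1 + r l m k t @[t --> F] --> (1 + 0 : R).
  by move=> lm; apply: cvgD; [exact: cvg_cst|exact: pr].
(* the limit is the expression in [E] with all four ratios set to 0 *)
rewrite (_ : 1 = (1 - 0 * 0)
  / Num.sqrt ((1 + 0) * (1 + 0) * (1 + 0) * (1 + 0)) :> R); last first.
  by rewrite mul0r subr0 addr0 !mulr1 sqrtr1 divr1.
under eq_fun do rewrite E.
apply: cvgM.
  apply: cvgB; first exact: cvg_cst.
  exact: (cvgM (pr _ _ ne comp1) (pr _ _ ne' comp2)).
apply: cvgV; first by rewrite addr0 !mulr1 sqrtr1 oner_neq0.
apply: (@cvg_comp _ _ _ _ Num.sqrt); last exact: sqrt_continuous.
by apply: cvgM; [apply: cvgM; [apply: cvgM|]|]; exact: D1.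
Qed.
End Asymptotics.

(** * The two-component mixture *)

Section Mixture.
Context {R : realType} {D N : nat}.
Variables (Y : 'I_N -> 'cV[R]_D) (C : 'I_N -> 'I_2) (i j : 'I_N).
Variables (Sigma0 : 'M[R]_D) (beta nu0 : R).

Let n (k : 'I_2) := size_b C i j k.
Let S (k : 'I_2) := scatter_b Y C i j Sigma0 k.
Let mu (k : 'I_2) := mean_b Y C i j k.

(** The suffix of [weight0], [weight1], [weight2] is the number of points of the
    pair [i], [j] that are allocated to component [k]; the value is the
    determinant factor that [k] then contributes to the joint probability. *)
Definition weight0 (k : 'I_2) : R := (\det (S k)) `^ (- ((n k)%:R / 2)).

Definition weight1 (k : 'I_2) (y : 'cV[R]_D) (d : R) : R :=
  (\det (S k + ((n k)%:R / ((n k)%:R + 1)) *: outer (d *: mu k - y)))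
    `^ (- (((n k)%:R + 1) / 2)).

Definition weight2 (k : 'I_2) (d : R) : R :=
  (\det (S k + (2 * (n k)%:R / ((n k)%:R + 2)) *: outer (d *: mu k)
         + V_b Y i j)) `^ (- (((n k)%:R + 2) / 2)).

Definition weight (l m : 'I_2) (d1 d2 : R) : R :=
  if l == m then weight2 l (if l == comp1 then d1 else d2)
                 * weight0 (if l == comp1 then comp2 else comp1)
  else weight1 comp1 (if l == comp1 then Y i else Y j) d1
       * weight1 comp2 (if l == comp1 then Y j else Y i) d2.

Lemma joint_weight (g d1 d2 : R) (l m : 'I_2) :
  joint Y C i j Sigma0 beta nu0 g d1 d2 l m =
  g * (Gamma_lm D C i j beta nu0 0 1 l m * weight l m d1 d2).
Proof.
have GE l' m' : Gamma_lm D C i j beta nu0 0 g l' m' =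
    g * Gamma_lm D C i j beta nu0 0 1 l' m'.
  by rewrite /Gamma_lm mul1r.
have I2 (k : 'I_2) : k = comp1 \/ k = comp2.
  by case: k => [[|[|//]]] p; [left|right]; apply/val_inj.
have E12 : (comp1 == comp2) = false by [].
have E21 : (comp2 == comp1) = false by [].
case: (I2 l) => ->; case: (I2 m) => ->;
  rewrite /joint /weight ?E12 ?E21 ?eqxx /p11 /p12 /p21 /p22 GE;
  move: (Gamma_lm _ _ _ _ _ _ _ _ _ _) => G; rewrite -2!mulrA.
- by [].
- by [].
- by [].
- by rewrite [weight2 _ _ * _]mulrC.
Qed.

Lemma weight1E k y d : weight1 k y d =
  (\det (S k + ((n k)%:R / ((n k)%:R + 1)) *: outer (d *: mu k - y)))
    `^ (- ((n k).+1%:R / 2)).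
Proof. by rewrite -[(n k).+1%:R]natr1. Qed.

Lemma weight2E k d : weight2 k d =
  (\det (S k + V_b Y i j
         + (2 * (n k)%:R / ((n k)%:R + 2)) *: outer (d *: mu k - 0)))
    `^ (- ((n k).+2%:R / 2)).
Proof. by rewrite subr0 /weight2 addrAC -[(n k).+2]addn2 natrD. Qed.

Hypotheses (Sigma0_pd : posdefmx Sigma0).
Hypothesis beta_pos : forall l m k : 'I_2, 0 < beta + (size_lm C i j l m k)%:R.
Hypothesis nu0_pos : forall (l m k : 'I_2) (r : nat), (1 <= r <= D)%N ->
     0 < nu0 + (size_lm C i j l m k)%:R + 1 - r%:R.
Hypothesis n_gt0 : forall k, (0 < n k)%N.
Hypothesis mu_neq0 : forall k, mu k != 0.

Lemma Gamma_lm_gt0 (l m : 'I_2) : 0 < Gamma_lm D C i j beta nu0 0 1 l m.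
Proof.
rewrite /Gamma_lm mul1r; apply: prodr_gt0 => k _.
rewrite divr_gt0 ?powR_gt0 // ?add0r.
  rewrite mulr_gt0 ?gammaf_gt0 // big_nat; apply: prodr_gt0 => r rD.
  exact/gammaf_gt0/nu0_pos.
rewrite ltr0n; apply: leq_trans (n_gt0 k) _.
exact: leq_trans (leq_addr _ _) (leq_addr _ _).
Qed.

Lemma posdefmx_scatter k : posdefmx (S k).
Proof. exact: posdefmxD_sum_outer. Qed.

Lemma posdefmx_scatterV k : posdefmx (S k + V_b Y i j).
Proof.
by rewrite /V_b addrA; do 2!apply: posdefmxD_outer; exact: posdefmx_scatter.
Qed.

Let nR k : 0 < (n k)%:R :> R. Proof. by rewrite ltr0n. Qed.

Let c1_gt0 k : 0 < (n k)%:R / ((n k)%:R + 1) :> R.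
Proof. by rewrite divr_gt0 // addr_gt0. Qed.

Let c2_gt0 k : 0 < 2 * (n k)%:R / ((n k)%:R + 2) :> R.
Proof. by rewrite divr_gt0 ?addr_gt0 ?mulr_gt0. Qed.

Lemma weight_gt0 (l m : 'I_2) (d1 d2 : R) : 0 < weight l m d1 d2.
Proof.
have w1 k y d : 0 < weight1 k y d.
  apply/powR_gt0/det_outer_gt0; first exact: posdefmx_scatter.
  exact: ltW.
have w2 k d : 0 < weight2 k d.
  rewrite weight2E; apply/powR_gt0/det_outer_gt0; first exact: posdefmx_scatterV.
  exact: ltW.
have w0 k : 0 < weight0 k.
  exact/powR_gt0/posdefmx_det_gt0/posdefmx_scatter.
by rewrite /weight; case: ifP => _; rewrite mulr_gt0.
Qed.

(** Splitting the pair costs a factor [d^-(n+1)] in each component, against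
    [d^-(n+2)] in component [k] alone when the pair stays together there. *)
Lemma weight_ratio_cvg0 {T : Type} {F : set_system T} {FF : Filter F}
    (u v : T -> R) (k k' : 'I_2) (y y' : 'cV[R]_D) (K w : R) :
  (forall t, 0 < u t) -> (forall t, 0 < v t) ->
  u t @[t --> F] --> +oo -> v t @[t --> F] --> +oo ->
  (exists2 c : R, 0 < c & \forall t \near F, u t <= c * v t) ->
  K * (weight1 k y (u t) * weight1 k' y' (v t) / (weight2 k (u t) * w))
    @[t --> F] --> 0.
Proof.
move=> u0 v0 uoo voo uv.
have Spos := posdefmx_scatter; have Vpos := posdefmx_scatterV.
have [L1 _ H1] :=
  det_outer_powR_cvg _ _ y _ _ (Spos k) (c1_gt0 k) (mu_neq0 k) u0 uoo (n k).+1.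
have [L2 _ H2] :=
  det_outer_powR_cvg _ _ y' _ _ (Spos k') (c1_gt0 k') (mu_neq0 k') v0 voo
    (n k').+1.
have [L3 L30 H3] :=
  det_outer_powR_cvg _ _ 0 _ _ (Vpos k) (c2_gt0 k) (mu_neq0 k) u0 uoo (n k).+2.
have E t :
    K * (weight1 k y (u t) * weight1 k' y' (v t) / (weight2 k (u t) * w)) =
    K / w * (weight1 k y (u t) * weight1 k' y' (v t) / weight2 k (u t)).
  move: (weight1 k y _) (weight1 k' y' _) (weight2 k _) => a b c.
  by rewrite invfM; ring.
under eq_fun do rewrite E !weight1E weight2E.
exact: (cvg_ratio0 (K / w) L1 L2 L3 (n k).+1 (n k') _ _ _ u v
  L30 u0 v0 voo (n_gt0 k') uv H1 H2 H3).
Qed.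

End Mixture.

Lemma eqO_pos_le {R : realType} {T : Type} (F : filter_on T) (u v : T -> R) :
  (forall t, 0 < u t) -> (forall t, 0 < v t) -> u =O_F v ->
  exists2 c : R, 0 < c & \forall t \near F, u t <= c * v t.
Proof.
move=> u0 v0 /eqO_exP [c c0 H]; exists c => //.
by apply: filterS H => t; rewrite !gtr0_norm.
Qed.

Theorem theorem1 (R : realType) (D N : nat)
  (Y : 'I_N -> 'cV[R]_D) (C : 'I_N -> 'I_2) (i j : 'I_N)
  (Sigma0 : 'M[R]_D) (beta nu0 : R) (gamma : R -> R -> R)
  (neq_ij : i != j)
  (Sigma0_pd : posdefmx Sigma0)
  (centered : 2^-1 *: (Y i + Y j) = 0)
  (beta_gt0 : 0 < beta) (nu0_gt0 : 0 < nu0)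
  (beta_arg_gt0 : forall l m k : 'I_2, 0 < beta + (size_lm C i j l m k)%:R)
  (nu0_arg_gt0 : forall (l m k : 'I_2) (r : nat), (1 <= r <= D)%N ->
     0 < nu0 + (size_lm C i j l m k)%:R + 1 - r%:R)
  (gamma_gt0 : forall d1 d2 : R, 0 < d1 -> 0 < d2 -> 0 < gamma d1 d2)
  (gamma_norm : forall d1 d2 : R, 0 < d1 -> 0 < d2 ->
     \sum_(l < 2) \sum_(m < 2)
       joint Y C i j Sigma0 beta nu0 (gamma d1 d2) d1 d2 l m = 1)
  (S1_nonsing : scatter_b Y C i j Sigma0 comp1 \in unitmx)
  (S2_nonsing : scatter_b Y C i j Sigma0 comp2 \in unitmx)
  (n1_gt0 : (0 < size_b C i j comp1)%N) (n2_gt0 : (0 < size_b C i j comp2)%N)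
  (mean1_neq0 : mean_b Y C i j comp1 != 0)
  (mean2_neq0 : mean_b Y C i j comp2 != 0)
  (T : Type) (F : filter_on T) (d1 d2 : T -> R)
  (d1_gt0 : forall t, 0 < d1 t) (d2_gt0 : forall t, 0 < d2 t)
  (d1_oo : d1 t @[t --> F] --> +oo) (d2_oo : d2 t @[t --> F] --> +oo)
  (d1_O_d2 : d1 =O_F d2) (d2_O_d1 : d2 =O_F d1) :
  corr (joint Y C i j Sigma0 beta nu0 (gamma (d1 t) (d2 t)) (d1 t) (d2 t))
    @[t --> F] --> (1 : R).
Proof.
have I2 (k : 'I_2) : k = comp1 \/ k = comp2.
  by case: k => [[|[|//]]] p; [left|right]; apply/val_inj.
have n_gt0 k : (0 < size_b C i j k)%N by case: (I2 k) => ->.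
have mu0 k : mean_b Y C i j k != 0 by case: (I2 k) => ->.
have Ggt0 := Gamma_lm_gt0 _ _ _ _ _ beta_arg_gt0 nu0_arg_gt0 n_gt0.
have wgt0 := weight_gt0 Y C i j Sigma0 Sigma0_pd n_gt0.
have uv := eqO_pos_le _ _ _ d1_gt0 d2_gt0 d1_O_d2.
have vu := eqO_pos_le _ _ _ d2_gt0 d1_gt0 d2_O_d1.
have g_gt0 t : 0 < gamma (d1 t) (d2 t) by apply: gamma_gt0.
apply: corr_cvg1 => [t l m|t|l m lm k].
- rewrite joint_weight; apply: mulr_gt0; first exact: g_gt0.
  by apply: mulr_gt0; [exact: Ggt0|exact: wgt0].
- exact: gamma_norm.
pose G l' m' := Gamma_lm D C i j beta nu0 0 1 l' m'.
pose W l' m' t := weight Y C i j Sigma0 l' m' (d1 t) (d2 t).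
have ratioE t :
    joint Y C i j Sigma0 beta nu0 (gamma (d1 t) (d2 t)) (d1 t) (d2 t) l m /
    joint Y C i j Sigma0 beta nu0 (gamma (d1 t) (d2 t)) (d1 t) (d2 t) k k =
    G l m / G k k * (W l m t / W k k t).
  rewrite !joint_weight -/(G l m) -/(G k k) -/(W l m t) -/(W k k t).
  move: (Ggt0 k k) (wgt0 k k (d1 t) (d2 t)) (g_gt0 t).
  rewrite -/(G k k) -/(W k k t).
  move: (G l m) (G k k) (W l m t) (W k k t) (gamma _ _) => x y z w g y0 w0 g0.
  by field; rewrite !gt_eqF.
under eq_fun do rewrite ratioE.
move: (G l m / G k k) => K.
case: (I2 l) lm => ->; case: (I2 m) => -> // _; case: (I2 k) => ->;
  rewrite /W /weight /=.
- exact: weight_ratio_cvg0.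
(* relative to [p22] the roles of the two components are exchanged *)
- under eq_fun do rewrite [X in _ * (X / _)]mulrC.
  exact: weight_ratio_cvg0.
- exact: weight_ratio_cvg0.
- under eq_fun do rewrite [X in _ * (X / _)]mulrC.
  exact: weight_ratio_cvg0.
Qed.
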